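(* Let $\mathcal L$ be an ultrafilter on $\omega$ coherent to no $Q$-point. Then $\omega^\omega$ can be written as the union of an increasing (with respect to inclusion) chain of its proper subsets, of length $\leq\mathfrak b(\mathcal L)$, such that each element of the chain is closed under composition of functions, and every $\sigma$-compact subset of $\omega^\omega$ is contained in one of the elements of this chain.
   Context: $\omega^\omega$ is the Baire space (the set of all functions $\omega\to\omega$ with the product topology of discrete spaces). All filters are assumed non-principal. For an ultrafilter $\mathcal F$ on $\omega$ and $x,y\in\omega^\omega$, $x\leq_{\mathcal F}y$ means $\{n:x(n)\leq y(n)\}\in\mathcal F$; $\mathfrak b(\mathcal F)$ is the cofinality of the linearly (pre)ordered set $(\omega^\omega,\leq_{\mathcal F})$. Ultrafilters $\mathcal F$ and $\mathcal U$ on $\omega$ are coherent if there is an increasing sequence $\langle k_n:n\in\omega\rangle$ of natural numbers such that for every $I\subset\omega$, $\bigcup_{n\in I}[k_n,k_{n+1})\in\mathcal F$ if and only if $\bigcup_{n\in I}[k_n,k_{n+1})\in\mathcal U$. An ultrafilter $\mathcal L$ is a $Q$-point if for every monotone (nondecreasing) surjection $\phi:\omega\to\omega$ there is $L\in\mathcal L$ such that $\phi\restriction L$ is injective. *)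

(* Defs.v *)
From mathcomp Require Import all_boot.
From mathcomp Require Import boolp classical_sets functions cardinality filter wochoice.
From mathcomp Require Import topology.

Set Implicit Arguments.
Unset Strict Implicit.
Unset Printing Implicit Defensive.

Local Open Scope classical_set_scope.
Local Open Scope card_scope.

(** nat carries the discrete topology, so this is the product topology. *)
Notation baire := {ptws nat -> nat}.

Definition sigma_compact (T : topologicalType) (K : set T) : Prop :=
  exists2 F : nat -> set T, (forall n, compact (F n)) & K = \bigcup_n F n.

Definition nonprincipal_ultrafilter (F : set_system nat) : Prop :=
  UltraFilter F /\ forall n, F <> principal_filter n.

Definition le_mod (F : set_system nat) (x y : nat -> nat) : Prop :=
  F [set n | (x n <= y n)%N].

Definition block_union (k : nat -> nat) (I : set nat) : set nat :=
  \bigcup_(n in I) [set m | (k n <= m < k n.+1)%N].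

(** The sequence k has to be strictly increasing: with eventually constant k
    any two nonprincipal ultrafilters would be coherent. *)
Definition coherent (F U : set_system nat) : Prop :=
  exists2 k : nat -> nat, {homo k : m n / (m < n)%N} &
    forall I : set nat, F (block_union k I) <-> U (block_union k I).

Definition Qpoint (F : set_system nat) : Prop :=
  nonprincipal_ultrafilter F /\
  forall phi : nat -> nat,
    {homo phi : m n / (m <= n)%N} -> set_surj setT setT phi ->
    exists2 A, F A & set_inj A phi.

(** Ordinals are represented by types with a (reflexive) well-order in the
    sense of [wochoice.well_order]; cardinals are initial ordinals. *)
Definition initial_ordinal (W : Type) (R : rel W) : Prop :=
  well_order R /\ forall w, ~ ([set: W] #<= [set v | R v w /\ v <> w]).

Definition ordinal_le (I W : Type) (R : rel I) (S : rel W) : Prop :=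
  exists2 f : I -> W, injective f & forall i j, R i j -> S (f i) (f j).

Definition cofinal (T : Type) (le : T -> T -> Prop) (B : set T) : Prop :=
  forall x, exists2 y, B y & le x y.

Definition is_cofinality (T : Type) (le : T -> T -> Prop)
    (W : Type) (S : rel W) : Prop :=
  initial_ordinal S /\
  exists B : set T, [/\ cofinal le B,
    forall B', cofinal le B' -> B #<= B' & [set: W] #= B].

Definition is_frakb (F : set_system nat) (W : Type) (S : rel W) : Prop :=
  is_cofinality (le_mod F) S.

Definition length_le_frakb (F : set_system nat) (I : Type) (R : rel I) : Prop :=
  exists (W : Type) (S : rel W), is_frakb F S /\ ordinal_le R S.

(* Main.v *)
Require Import Defs.
From mathcomp Require Import all_boot.
From mathcomp Require Import boolp classical_sets functions cardinality filter wochoice.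
From mathcomp Require Import topology.

(** Each set of the chain consists of functions that shift certain finite
    sequences of natural numbers: what lies below the [i]-th term is mapped
    below the [j]-th term, where [j] depends only on [i].

    Fix [b : nat -> nat] and [h : nat -> nat]. A spaced chain in a set [A] of
    length [l] is a sequence [s 0, .., s l] of elements of [A] with
    [b (s i) <= s (i + 1)] whose terms all lie below [h (s 0)]. The set
    [chain_shifting L b h] consists of the [f] such that for each [i] there is
    [j] with [f x <= s j] for all [x <= s i], uniformly over all spaced chains
    of large enough length in a small enough set of [L]. Such a set
    - is closed under composition, since the two shifts can be performed one
      after the other ([chain_shifting_comp]);
    - contains every [f] whose running maximum is below [b] modulo [L]: one step
      along the chain suffices ([le_mod_chain_shifting]);
    - omits [h], provided arbitrarily long spaced chains exist in every element
      of [L] ([chain_shifting_proper]).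

    The hypothesis on [L] gives, for every [b], an [h] of the last kind
    ([long_spaced_chains]). Indeed, cut [nat] into blocks such that [b] sends
    any number at most up to the end of the next block, and let [p] send a
    number to the start of its block. The image [p @ L] is coherent to [L]
    through these blocks, so it is not a Q-point: some monotone surjection [psi]
    is injective on no element of it. Take for [h x] a bound for the numbers
    with the same [psi (p _)] as [x]. If some [A] in [L] had only spaced chains
    of length less than [l], then, after shrinking [A] to blocks of one parity,
    so that elements of different blocks are far apart, [A] would be split into
    finitely many pieces by the length of the longest chain with constant
    [psi (p _)] ending at a given element, and [psi] would be injective on the
    image under [p] of each piece.

    Finally, let the well-ordered set [W] represent the cardinal b(L). Since
    modulo [L] the order is linear and no family of fewer than b(L) functions is
    cofinal, there are functions [b w], for [w] in [W], such that each function
    is below [b v] modulo [L] for all large enough [v]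
    ([exists_frakb_scale]). The sets
    [C w = \bigcap_(v >= w) chain_shifting L (b v) (h v)] increase with [w],
    and keeping the first index of each value makes the chain strictly
    increasing. A sigma-compact set is dominated, modulo finite sets, by a
    single function, and therefore lies in some [C w]. *)

Local Open Scope classical_set_scope.
Local Open Scope card_scope.

(** * Well-orders *)

Lemma exists_well_order (T : Type) : exists R : rel T, well_order R.
Proof. by elim/Peq: T => T; have [R wR] := well_ordering_principle T; exists R. Qed.

Section WellOrder.
Context {T : Type} {R : rel T} (wR : well_order R).

Lemma wo_least (P : T -> Prop) :
  (exists x, P x) -> exists2 z, P z & forall x, P x -> R z x.
Proof.
move=> [x Px].
have [|z [[Pz zmin] _]] := wR (fun y => `[< P y >]).
  by exists x; rewrite unfold_in; apply/asboolP.
exists z; first by move: Pz; rewrite unfold_in => /asboolP.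
by move=> y Py; apply: zmin; rewrite unfold_in; apply/asboolP.
Qed.

Lemma wo_total (x y : T) : R x y \/ R y x.
Proof.
have [|z [->|->] zmin] := @wo_least (fun z => z = x \/ z = y).
- by exists x; left.
- by left; apply: zmin; right.
- by right; apply: zmin; left.
Qed.

Lemma wo_refl (x : T) : R x x.
Proof. by have [] := wo_total x x. Qed.

Lemma wo_anti (x y : T) : R x y -> R y x -> x = y.
Proof.
move=> Rxy Ryx.
have [|z [_ zuniq]] := wR (fun z => `[< z = x \/ z = y >]).
  by exists x; rewrite unfold_in; apply/asboolP; left.
have zE u : u = x \/ u = y -> z = u.
  move=> uxy; apply: zuniq; split; first by rewrite unfold_in; apply/asboolP.
  by case: uxy => -> v; rewrite unfold_in => /asboolP[->|->] //; exact: wo_refl.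
by rewrite -(zE x) ?(zE y); [| right | left].
Qed.

Lemma wo_trans (x y z : T) : R x y -> R y z -> R x z.
Proof.
move=> Rxy Ryz.
have [|m mP mmin] := @wo_least (fun u => [\/ u = x, u = y | u = z]).
  by exists x; constructor.
have [mx my mz] : [/\ R m x, R m y & R m z] by split; apply: mmin; constructor.
case: mP => mE; subst m => //.
- by rewrite (wo_anti _ _ Rxy mx).
- by rewrite -(wo_anti _ _ Ryz my).
Qed.

Lemma wo_inj {U : Type} (f : U -> T) :
  injective f -> well_order (fun u v => R (f u) (f v)).
Proof.
move=> finj A [u0 Au0].
have [|_ [u Au <-] umin] := @wo_least (fun x => exists2 u, u \in A & f u = x).
  by exists (f u0), u0.
exists u; split.
  by split=> // v Av; apply: umin; exists v.
move=> v [Av vmin]; apply: finj; apply: wo_anti.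
  by apply: umin; exists v.
exact: vmin.
Qed.

End WellOrder.

(** * Minimal cardinalities and initial ordinals *)

Lemma card_le_inj {T U : Type} (A : set T) (B : set U) (f : T -> U) :
  (forall x, A x -> B (f x)) -> {in A &, injective f} -> A #<= B.
Proof.
move=> fAB finj; rewrite -(card_le_eql (inj_card_eq finj)).
by apply: subset_card_le => _ [x Ax <-]; exact: fAB.
Qed.

Lemma card_le_surj {T U : Type} (A : set T) (B : set U) (f : T -> U) :
  (forall y, B y -> exists2 x, A x & f x = y) -> B #<= A.
Proof.
move=> fsurj; apply: card_le_trans (card_image_le f A).
by apply: subset_card_le => y /fsurj[x Ax <-]; exists x.
Qed.


(** Cardinals are well-founded. A maximal family of choice functions that are
    pairwise different at each member of [F] has its values at some member [B0]
    exhausting [B0]; hence [B0] injects into the family, which injects into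
    every member. *)
Lemma exists_least_card {T : pointedType} (F : set (set T)) :
  F !=set0 -> exists2 B0, F B0 & forall B, F B -> B0 #<= B.
Proof.
move=> [B1 FB1].
pose P (M : set (set T -> T)) :=
  (forall c B, M c -> F B -> B (c B)) /\
  (forall c d B, M c -> M d -> F B -> c B = d B -> c = d).
have [|M [[Mmem Minj] Mmax]] := @Zorn_bigcup _ P.
  move=> G GP Gtot; split.
    by move=> c B [X GX Xc] FB; have [mem _] := GP _ GX; exact: (mem c B).
  move=> c d B [X GX Xc] [Y GY Yd] FB cd.
  have [XY|YX] := Gtot _ _ GX GY.
  - by have [_ inj] := GP _ GY; apply: (inj c d B) => //; exact: XY.
  - by have [_ inj] := GP _ GX; apply: (inj c d B) => //; exact: YX.
have [B0 FB0 B0M] : exists2 B0, F B0 &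
    forall t, B0 t -> exists2 c, M c & c B0 = t.
  (* Otherwise each member has an unused value, and these form a new choice
     function. *)
  apply: contrapT => noB0.
  have /choice[c cP] : forall B, exists t, F B -> B t /\ forall d, M d -> d B <> t.
    move=> B; have [FB|] := pselect (F B); last by exists point.
    apply: contrapT => Bbad; apply: noB0; exists B => // t Bt.
    apply: contrapT => nt; apply: Bbad; exists t => _; split=> // d Md dB.
    by apply: nt; exists d.
  apply: (Mmax (M `|` [set c])).
    split; first by move=> d; left.
    by move=> /(_ c (or_intror erefl)) Mc; have [_ /(_ c Mc)] := cP _ FB1.
  split=> [d B [Md|->] FB|d e B].
  - exact: (Mmem d B).
  - by have [] := cP _ FB.
  - move=> [Md|->] [Me|->] FB dBeB //.
    + exact: Minj dBeB.
    + by have [_ /(_ d Md)] := cP _ FB.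
    + by have [_ /(_ e Me) []] := cP _ FB.
exists B0 => // B FB.
apply: card_le_trans (card_le_surj M B0 (fun c => c B0) B0M) _.
apply: (card_le_inj _ _ (fun c => c B)) => [c Mc|c d Mc Md]; first exact: (Mmem c B).
by apply: Minj => //; exact: set_mem.
Qed.

(** In a well-order of [A], the least initial segment equinumerous with [A], or
    the whole of [A] if there is none, is an initial ordinal. *)
Lemma exists_initial_ordinal {T : Type} (A : set T) :
  exists (W : Type) (S : rel W), initial_ordinal S /\ [set: W] #= A.
Proof.
have [R wR] := exists_well_order (set_type A).
have [[w0 w0P]|noseg] := pselect
  (exists w, [set: set_type A] #<= [set v | R v w /\ v <> w]).
  have [w wP wmin] := wo_least wR
    (fun w => [set: set_type A] #<= [set v | R v w /\ v <> w])
    (ex_intro _ w0 w0P).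
  pose W := set_type [set v | R v w /\ v <> w].
  exists W, (fun u v => R (val u) (val v)).
  have WA : [set: W] #= A.
    apply: Cantor_Bernstein.
      rewrite (card_le_eql (card_setT _)); apply: card_le_trans (card_leT _) _.
      by rewrite (card_le_eql (card_setT _)) card_lexx.
    by rewrite (card_le_eqr (card_setT _)) -(card_le_eql (card_setT _)).
  split=> //; split; first exact: (wo_inj wR _ val_inj).
  move=> v Wv.
  have [Rvw vw] := set_mem (valP v); apply: vw; apply: (wo_anti wR _ _ Rvw).
  apply: wmin; rewrite (card_le_eql (card_setT _)) -(card_le_eql WA).
  apply: card_le_trans Wv _.
  apply: (card_le_inj _ _ val) => [u [Ruv uv]|u u' _ _]; last exact: val_inj.
  by split=> // /val_inj.
exists (set_type A), R; split; last exact: card_setT.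
by split=> // w wP; apply: noseg; exists w.
Qed.

(** * The order modulo an ultrafilter, and its cofinality *)

Section NonprincipalUltrafilter.
Context {L : set_system nat} (hL : nonprincipal_ultrafilter L).

#[local] Instance ultraL : UltraFilter L := hL.1.

(** All cofinite sets belong to [L]; final segments suffice here. *)
Lemma tail_mem (n : nat) : L [set m | n <= m].
Proof.
elim: n => [|n IHn]; first by apply: filterS filterT => m _ /=.
have [Ln|Ln] := in_ultra_setVsetC [set n] ultraL.
  case: (hL.2 n); have [_ prinmax] := principal_filter_ultra n.
  by apply: prinmax => A An; apply: filterS Ln => m ->; exact: An.
apply: filterS (filterI IHn Ln) => m [/= nm /eqP].
by rewrite ltn_neqAle eq_sym nm andbT.
Qed.

Lemma le_mod_total (x y : nat -> nat) : le_mod L x y \/ le_mod L y x.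
Proof.
have [|Lxy] := in_ultra_setVsetC [set n | x n <= y n] ultraL; first by left.
by right; apply: filterS Lxy => n /= /negP; rewrite -ltnNge => /ltnW.
Qed.

Lemma le_mod_trans (y x z : nat -> nat) :
  le_mod L x y -> le_mod L y z -> le_mod L x z.
Proof. by move=> xy yz; apply: filterS2 xy yz => n; exact: leq_trans. Qed.

Lemma le_mod_refl (x : nat -> nat) : le_mod L x x.
Proof. by apply: filterS filterT => n _ /=. Qed.

(** The cardinal b(L) exists and indexes a family such that each function is
    eventually below its members. An enumeration of a cofinal set need not have
    this property; its member at [w] is replaced by a bound for all members up
    to [w], which exists because fewer than b(L) functions are not cofinal. *)
Lemma exists_frakb_scale :
  exists (W : Type) (S : rel W) (b : W -> nat -> nat), is_frakb L S /\
    forall f, exists w, forall v, S w v -> le_mod L f (b v).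
Proof.
have [|B cofB Bmin] := @exists_least_card (nat -> nat) (cofinal (le_mod L)).
  by exists setT => x; exists x => //; exact: le_mod_refl.
have [W [S [[wS S_init] WB]]] := exists_initial_ordinal B.
have [e eB] : exists e : W -> nat -> nat, set_surj setT B e.
  by apply/pcard_surjP; rewrite (card_le_eqr WB) card_lexx.
have notcof w : ~ cofinal (le_mod L) (e @` [set v | S v w /\ v <> w]).
  move=> /Bmin; rewrite -(card_le_eql WB) => Wle.
  by apply: (S_init w); apply: card_le_trans Wle (card_image_le _ _).
have /choice[b bP] w : exists x, forall v, S v w -> le_mod L (e v) x.
  have [x xP] : exists x, forall v, S v w -> v <> w -> le_mod L (e v) x.
    apply: contrapT => nox; apply: (notcof w) => x.
    apply: contrapT => nv; apply: nox; exists x => v Svw vw.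
    have [//|xv] := le_mod_total (e v) x.
    by case: nv; exists (e v) => //; exists v.
  exists (fun n => maxn (x n) (e w n)) => v Svw.
  have [->|vw] := pselect (v = w).
    by apply: filterS filterT => n _ /=; exact: leq_maxr.
  apply: le_mod_trans (xP v Svw vw) _.
  by apply: filterS filterT => n _ /=; exact: leq_maxl.
exists W, S, b; split; first by split=> //; exists B.
move=> f; have [y By fy] := cofB f; have [w _ ewy] := eB y By.
by exists w => v Swv; apply: le_mod_trans fy _; rewrite -ewy; exact: bP.
Qed.

Lemma ultra_fmap (g : nat -> nat) : UltraFilter (g @ L).
Proof.
split=> [|G GP LG]; first exact: fmap_proper_filter.
apply/seteqP; split=> // B GB.
have [//|LB] := in_ultra_setVsetC (g @^-1` B) ultraL.
have GBC : G (~` B) by apply: LG.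
by have [m []] := filter_ex (filterI GB GBC).
Qed.

End NonprincipalUltrafilter.

(** * Blocks adapted to a function *)

Section Blocks.
Variable b : nat -> nat.

(** Starting points of consecutive blocks covering [nat]; each point is so large
    that [b] maps every number up to the previous point at most to it. *)
Fixpoint block_start (n : nat) : nat :=
  if n is p.+1 then
    (block_start p + \max_(z < (block_start p).+1) b z).+1
  else 0.

Lemma block_start_lt : {homo block_start : m n / m < n}.
Proof.
by apply: homo_ltn => [m n p|n]; [exact: ltn_trans | rewrite ltnS leq_addr].
Qed.

Lemma block_start_le : {homo block_start : m n / m <= n}.
Proof. by apply: ltnW_homo; exact: block_start_lt. Qed.

Lemma le_block_start (n z : nat) : z <= block_start n -> b z <= block_start n.+1.
Proof.
move=> zn /=; apply: leqW; apply: leq_trans (leq_addl _ _).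
by rewrite -ltnS in zn; exact: (leq_bigmax (Ordinal zn)).
Qed.

Lemma block_start_ge (n : nat) : n <= block_start n.
Proof.
elim: n => // n IHn.
by apply: leq_ltn_trans IHn (block_start_lt _ _ (ltnSn n)).
Qed.

Lemma block_exists (m : nat) :
  exists n, block_start n <= m < block_start n.+1.
Proof.
elim: m => [|m [n /andP[nm mn]]]; first by exists 0.
have [?|mn'] := ltnP m.+1 (block_start n.+1); first by exists n; rewrite leqW.
exists n.+1; apply/andP; split=> //; apply: leq_ltn_trans mn _.
exact: block_start_lt.
Qed.

(** The index of the block containing [m]; the default value 0 is never used. *)
Definition block (m : nat) : nat :=
  xget 0 [set n | block_start n <= m < block_start n.+1].

Lemma blockP (m : nat) : block_start (block m) <= m < block_start (block m).+1.
Proof. by rewrite /block; case: xgetP => // H; have [n /H] := block_exists m. Qed.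

Lemma block_unique (n m : nat) :
  block_start n <= m < block_start n.+1 -> block m = n.
Proof.
move=> /andP[nm mn]; have /andP[bm mb] := blockP m.
apply/eqP; rewrite eqn_leq; apply/andP; split; rewrite leqNgt; apply/negP.
  by move=> /block_start_le /(leq_trans mn); rewrite leqNgt ltnS bm.
by move=> /block_start_le /(leq_trans mb); rewrite leqNgt ltnS nm.
Qed.

Lemma block_startK (n : nat) : block (block_start n) = n.
Proof. by apply: block_unique; rewrite leqnn block_start_lt. Qed.

Lemma le_of_block_lt (x y : nat) : (block x).+1 < block y -> b x <= y.
Proof.
move=> xy; have /andP[_ /ltnW /le_block_start xb] := blockP x.
have /andP[yb _] := blockP y.
exact: leq_trans xb (leq_trans (block_start_le _ _ xy) yb).
Qed.

End Blocks.

(** * Long spaced chains *)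

(** The terms [s 0, .., s l] form a chain in [A] whose gaps are controlled by [b]
    and whose extent is controlled by [h]; later values of [s] play no role. *)
Definition spaced_chain (b h : nat -> nat) (A : set nat) (l : nat)
    (s : nat -> nat) : Prop :=
  [/\ forall i, i <= l -> A (s i),
      forall i, i < l -> b (s i) <= s i.+1 &
      forall i, i <= l -> s i < h (s 0)].

Section ChainLevels.
Context (b g : nat -> nat) (A : set nat).

(** The last elements of chains of [l.+1] elements of [A] that are spaced by [b]
    and on which [g] is constant. *)
Fixpoint chain_end (l : nat) : set nat :=
  if l is p.+1 then
    [set y | A y /\ exists x, [/\ chain_end p x, b x <= y & g x = g y]]
  else A.

Lemma chain_endP (l y : nat) : chain_end l y -> exists s : nat -> nat,
  [/\ s l = y, forall i, i <= l -> A (s i),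
      forall i, i < l -> b (s i) <= s i.+1 &
      forall i, i <= l -> g (s i) = g y].
Proof.
elim: l y => [|l IHl] y /=.
  by move=> Ay; exists (fun=> y); split.
move=> [Ay [x [/IHl[s [sl sA sb sg]] bxy gxy]]].
exists (fun i => if i <= l then s i else y); split=> [|i il|i|i il].
- by rewrite ltnn.
- by case: ifP => // /sA.
- move=> /ltnSE; case: (ltngtP i l) => // [il|->] _; first by rewrite sb.
  by rewrite sl.
- by case: ifP => // /sg ->.
Qed.

End ChainLevels.

(** This is the only place where the absence of Q-points coherent to [L] is
    used. *)
Lemma long_spaced_chains {L : set_system nat}
    (hL : nonprincipal_ultrafilter L)
    (hLQ : forall Q : set_system nat, Qpoint Q -> ~ coherent L Q)
    (b : nat -> nat) :
  exists h, forall A l, L A -> exists s, spaced_chain b h A l s.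
Proof.
have uL := hL.1.
apply: contrapT => noh.
pose k := block_start b; pose p x := k (block b x).
apply: (hLQ (p @ L)); last first.
  (* [p] maps each block into itself. *)
  exists k; first exact: block_start_lt.
  move=> I; suff -> : (p @ L) (block_union k I) = L (block_union k I) by [].
  congr L; apply/seteqP; split=> m [n In /andP[nm mn]]; exists n => //.
    have <- : block b (p m) = n by apply: block_unique; rewrite nm.
    by rewrite /p block_startK; exact: blockP.
  have pm : p m = k n by rewrite /p (@block_unique b n) ?nm.
  rewrite /preimage /mkset pm; apply/andP; split=> //.
  exact: block_start_lt.
split; first split; first exact: ultra_fmap.
  move=> n pn.
  have pLn : L (p @^-1` [set n]) by change ((p @ L) [set n]); rewrite pn.
  have [m [mn nm]] := filter_ex (filterI pLn (tail_mem hL (k n.+1))).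
  have {}mn : p m = n := mn; have {}nm : k n.+1 <= m := nm.
  have /andP[_] := blockP b m; rewrite ltnNge => /negP; apply.
  apply: leq_trans nm.
  apply: block_start_le; rewrite ltnS -mn.
  exact: block_start_ge.
move=> psi psi_homo psi_surj.
have /choice[M MP] N : exists M, forall y, psi (p y) = N -> y < M.
  have [z _ zN] := psi_surj N.+1 I; exists (k z) => y yN.
  have pyz : p y < z.
    by rewrite ltnNge; apply/negP => /psi_homo; rewrite zN yN ltnn.
  have /andP[_ yb] := blockP b y; apply: leq_trans yb _.
  by apply: block_start_le; apply: leq_ltn_trans pyz; exact: block_start_ge.
have [A0 [l [LA0 nochain]]] : exists A l,
    L A /\ forall s, ~ spaced_chain b (fun x => M (psi (p x))) A l s.
  apply: contrapT => H; apply: noh; exists (fun x => M (psi (p x))) => A l LA.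
  by apply: contrapT => nos; apply: H; exists A, l; split=> // s As;
  apply: nos; exists s.
(* Elements of different blocks of the same parity are separated by a whole
   block, hence spaced by [b]. *)
have [c Lc] : exists c, L [set x | odd (block b x) = c].
  have [?|LC] := in_ultra_setVsetC [set x | odd (block b x) = true] uL.
    by exists true.
  by exists false; apply: filterS LC => x /= /negP/negbTE.
pose A := A0 `&` [set x | odd (block b x) = c].
pose E := chain_end b (psi \o p) A.
have LE0 : L (E 0) by exact: filterI.
have LEl : ~ L (E l).
  move=> /filter_ex[y /chain_endP[s [_ sA sb sg]]].
  apply: (nochain s); split=> // i il; first by case: (sA i il).
  by apply: MP; rewrite /= in sg; rewrite (sg i) ?(sg 0).
(* [D] consists of the elements at which the longest spaced chain with constant
   [psi \o p] has length [n]. *)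
have [n LEn nLEn] : exists2 n, L (E n) & ~ L (E n.+1).
  apply: contrapT => H; apply: LEl; elim: l {nochain} => // l IHl.
  by apply: contrapT => nL; apply: H; exists l.
pose D := E n `\` E n.+1.
have LD : L D.
  by have [//|] := in_ultra_setVsetC (E n.+1) uL; exact: filterI.
have EA m x : E m x -> A x by case: m => // m [].
(* Two such elements with the same value of [psi \o p] lie in one block, since
   otherwise the longest chain at the first extends to the second. *)
have Dsep x y : D x -> D y -> psi (p x) = psi (p y) -> p x < p y -> False.
  move=> [Ex _] [Ey nEy] xy pxy; apply: nEy; split; first exact: EA Ey.
  exists x; split=> //; apply: le_of_block_lt.
  have bxy : block b x < block b y.
    by rewrite ltnNge; apply/negP => /(@block_start_le b);
      rewrite leqNgt -/k -/(p x) -/(p y) pxy.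
  rewrite ltn_neqAle bxy andbT; apply/eqP => bE.
  have [_ /= xc] := EA _ _ Ex; have [_ /= yc] := EA _ _ Ey.
  by move: yc; rewrite -bE /= xc; case: (c).
exists (p @` D).
  have : L (p @^-1` (p @` D)) by apply: filterS LD => x Dx; exists x.
  by [].
move=> _ _ /set_mem[x Dx <-] /set_mem[y Dy <-] xy.
have [/Dsep|/Dsep|//] := ltngtP (p x) (p y); last by move=> /(_ Dy Dx) [].
by move=> /(_ Dx Dy) [].
Qed.

(** * Functions that shift spaced chains *)

(** The functions [f] that map everything up to the [i]-th term of a spaced
    chain at most to its [j]-th term, where [j] depends only on [i]; the chains are
    restricted to a set [A] of [L] and to lengths at least [l], both depending
    on [i]. No relation between [i], [j] and [l] is required: lengths can always
    be increased, by [spaced_chainS]. *)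
Definition chain_shifting (L : set_system nat) (b h : nat -> nat) :
    set (nat -> nat) :=
  [set f | forall i, exists j A l, L A /\
     forall s, spaced_chain b h A l s -> forall x, x <= s i -> f x <= s j].

Section ChainShifting.
Context {L : set_system nat} (pL : ProperFilter L) (b h : nat -> nat).

Lemma spaced_chainS (A A' : set nat) (l l' : nat) (s : nat -> nat) :
  A `<=` A' -> l' <= l -> spaced_chain b h A l s -> spaced_chain b h A' l' s.
Proof.
move=> AA' l'l [sA sb sh]; split=> i il'.
- by apply: AA'; apply: sA; exact: leq_trans l'l.
- by apply: sb; exact: leq_trans l'l.
- by apply: sh; exact: leq_trans l'l.
Qed.

Lemma chain_shifting_comp (f g : nat -> nat) :
  chain_shifting L b h f -> chain_shifting L b h g ->
  chain_shifting L b h (f \o g).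
Proof.
move=> Gf Gg i; have [j [A [l [LA gP]]]] := Gg i.
have [j' [A' [l' [LA' fP]]]] := Gf j.
exists j', (A `&` A'), (maxn l l'); split; first exact: filterI.
move=> s sP x xi; apply: fP.
  by apply: spaced_chainS sP; [exact: subIsetr | exact: leq_maxr].
apply: gP xi.
by apply: spaced_chainS sP; [exact: subIsetl | exact: leq_maxl].
Qed.

Lemma le_mod_chain_shifting (f : nat -> nat) :
  le_mod L (fun n => \max_(x < n.+1) f x) b -> chain_shifting L b h f.
Proof.
move=> fb i; exists i.+1, [set n | \max_(x < n.+1) f x <= b n], i.+1.
split; first exact: fb.
move=> s [sA sb _] x xi; apply: leq_trans (sb i _) => //.
apply: leq_trans (sA i (leqnSn i)).
by rewrite -ltnS in xi; exact: (leq_bigmax (Ordinal xi)).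
Qed.

Lemma chain_shifting_proper :
  (forall A l, L A -> exists s, spaced_chain b h A l s) ->
  ~ chain_shifting L b h h.
Proof.
move=> long /(_ 0)[j [A [l [LA hP]]]].
have [s sP] := long A (maxn l j) LA.
have hj : h (s 0) <= s j.
  by apply: hP => //; apply: spaced_chainS sP => //; exact: leq_maxl.
by case: sP => _ _ /(_ j (leq_maxr _ _)); rewrite ltnNge hj.
Qed.

End ChainShifting.

(** * Compact sets of functions *)

Lemma compact_baire_bounded (K : set baire) :
  compact K -> forall m, exists n, forall f, K f -> f m <= n.
Proof.
move=> cK m; apply: contrapT => unb.
have unbP n : exists2 f, K f & n < f m.
  apply: contrapT => H; apply: unb; exists n => f Kf.
  by rewrite leqNgt; apply/negP => nf; apply: H; exists f.
pose F : set_system baire := filter_from setT (fun n => [set f | K f /\ n <= f m]).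
have FF : ProperFilter F.
  apply: filter_from_proper => [|n _]; last first.
    by have [f Kf /ltnW nf] := unbP n; exists f.
  apply: filter_from_filter; first by exists 0.
  move=> i j _ _; exists (maxn i j) => // f [Kf].
  by rewrite geq_max => /andP[].
have [|f [Kf Ff]] := cK F FF.
  by exists 0 => // f [].
have fm : nbhs f [set g : baire | g m = f m].
  exact: (@proj_continuous nat (fun=> nat) m f _ (discrete_set1 (f m))).
have [g [[_ /=]]] := Ff [set g | K g /\ (f m).+1 <= g m] _
  (ex_intro2 _ _ (f m).+1 I (fun _ => id)) fm.
by move=> fg gf; rewrite gf ltnn in fg.
Qed.

(** The running maxima of all members of a sigma-compact set are eventually
    below one function, a diagonal bound for the countably many compact
    pieces. *)
Lemma sigma_compact_dominated (K : set baire) : sigma_compact K ->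
  exists d : nat -> nat, forall f, K f -> exists n0, forall n, n0 <= n ->
    \max_(x < n.+1) f x <= d n.
Proof.
move=> [F cF ->].
have /choice[B BP] : forall nm : nat * nat,
    exists N, forall f : baire, F nm.1 f -> f nm.2 <= N.
  by move=> [n m]; exact: compact_baire_bounded (cF n) m.
exists (fun n => \max_(i < n.+1) \max_(x < n.+1) B (i : nat, x : nat)).
move=> f [i _ Fif]; exists i => n; rewrite -ltnS => il.
apply: leq_trans (leq_bigmax (Ordinal il)); apply/bigmax_leqP => x _ /=.
by apply: leq_trans (leq_bigmax x); exact: (BP (i, x : nat)).
Qed.

(** * The chain *)

Theorem corollary1p4 (L : set_system nat)
  (hL : nonprincipal_ultrafilter L)
  (hLQ : forall Q : set_system nat, Qpoint Q -> ~ coherent L Q) :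
  exists (I : Type) (R : rel I) (C : I -> set baire),
    (well_order R /\ length_le_frakb L R) /\
    (forall i j, R i j -> i <> j -> C i `<` C j) /\
    (forall i, C i `<` setT) /\
    \bigcup_i C i = setT /\
    (forall i (f g : baire), C i f -> C i g -> C i (f \o g)) /\
    (forall K : set baire, sigma_compact K -> exists i, K `<=` C i).
Proof.
have uL := hL.1.
have [W [S [b [frakS scale]]]] := exists_frakb_scale hL.
have wS : well_order S := frakS.1.1.
have /choice[h long] w := long_spaced_chains hL hLQ (b w).
pose C0 w : set baire :=
  [set f | forall v, S w v -> chain_shifting L (b v) (h v) f].
have C0S v w : S v w -> C0 v `<=` C0 w.
  by move=> Svw f Cf u Swu; apply: Cf; exact: wo_trans Swu.
have C0dom (d : nat -> nat) : exists w, forall f : baire,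
    le_mod L (fun n => \max_(x < n.+1) f x) d -> C0 w f.
  have [w wP] := scale d; exists w => f fd v Swv.
  by apply: le_mod_chain_shifting; exact: le_mod_trans fd (wP v Swv).
(* [P w]: the index [w] is the first one with its value of [C0]. *)
pose P w := forall v, S v w -> C0 v = C0 w -> v = w.
have C0P w : exists2 v, P v & C0 v = C0 w.
  have [v vw vmin] := wo_least wS (fun v => C0 v = C0 w) (ex_intro _ w erefl).
  exists v => // u Suv uv; apply: (wo_anti wS) => //.
  by apply: vmin; rewrite uv.
have inh : forall w, exists i : {v | P v}, C0 (sval i) = C0 w.
  by move=> w; have [v Pv vw] := C0P w; exists (exist _ v Pv).
have svalI : injective (@sval W P) by move=> u v; exact: eq_sig_hprop.
exists {v | P v}, (fun u v => S (sval u) (sval v)), (fun u => C0 (sval u)).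
split; last split; last split; last split; last split.
- split; first exact: wo_inj.
  by exists W, S; split=> //; exists sval.
- move=> u v Suv uv; split; first exact: C0S.
  move=> Cvu; apply: uv; apply: svalI; apply: (proj2_sig v) => //.
  by apply/seteqP; split=> //; exact: C0S.
- move=> u; split=> // /(_ (h (sval u)) I) /(_ _ (wo_refl wS _)).
  by apply: chain_shifting_proper; exact: long.
- apply/seteqP; split=> // f _.
  have [w wP] := C0dom (fun n => \max_(x < n.+1) f x).
  have [u uw] := inh w; exists u => //=; rewrite uw; apply: wP.
  exact: le_mod_refl.
- by move=> u f g Cf Cg v Suv; apply: chain_shifting_comp; [exact: Cf | exact: Cg].
- move=> K /sigma_compact_dominated[d dP]; have [w wP] := C0dom d.
  have [u uw] := inh w; exists u => f /dP[n0 fd]; rewrite uw; apply: wP.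
  by apply: filterS (tail_mem hL n0) => n; exact: fd.
Qed.
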